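(* Let $t\in\mathbb{R}\setminus\mathbb{Z}_{\ge 0}$. The $t$-deformed cumulants $\{\kappa_i^t\}_{i\in\mathbb{Z}_{\ge1}}$, viewed as maps $\kappa_i^t:U\to\mathbb{R}$, satisfy the following three conditions, and they are the unique sequence of maps $U\to\mathbb{R}$ satisfying them: (i) For every $i\ge 1$, $\kappa_i^t(A)$ is a polynomial in $p_1(A),\dots,p_i(A)$ with leading term $\frac{t^{i-1}}{(t)_{\underline{i}}}p_i(A)$; that is, there exists a polynomial $F_i$ in $i-1$ variables (independent of $A$) such that for all $A\in U$ $$\kappa_i^t(A)=\frac{t^{i-1}}{(t)_{\underline{i}}}\,p_i(A)+F_i\bigl(p_1(A),\dots,p_{i-1}(A)\bigr).$$ (ii) Homogeneity: $\kappa_i^t(D_r[A])=r^i\kappa_i^t(A)$ for all $A\in U$, $r\in\mathbb{R}$ and $i\in\mathbb{Z}_{\ge1}$. (iii) Additivity: $\kappa_i^t(A\boxplus^t B)=\kappa_i^t(A)+\kappa_i^t(B)$ for all $A,B\in U$ and $i\in\mathbb{Z}_{\ge1}$; in other words, $C^t[A\boxplus^t B](z)=C^t[A](z)+C^t[B](z)$.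
   Context: $(t)_{\underline{k}}=t(t-1)\cdots(t-k+1)$ is the falling factorial, $(t)_{\underline{0}}=1$. $U=1+z\mathbb{R}\llbracket z\rrbracket$ is the set of real formal power series with constant term $1$. For $t\in\mathbb{R}\setminus\mathbb{Z}_{\ge0}$ and $A(z)=\sum_{k\ge0}a_kz^k$, $B(z)=\sum_{k\ge0}b_kz^k$ in $\mathbb{R}\llbracket z\rrbracket$, the $t$-deformed convolution is $$(A\boxplus^tB)(z)=\sum_{k=0}^\infty\sum_{i+j=k}\frac{(t)_{\underline{k}}}{(t)_{\underline{i}}(t)_{\underline{j}}}a_ib_jz^k .$$ Here $\log$ is the formal logarithm $\log(1+z)=\sum_{k\ge1}\frac{(-1)^{k-1}}{k}z^k$. For $A=1+\sum_{k\ge1}a_kz^k\in U$, the ''power sums'' $p_k(A)$ are defined by $\sum_{k=1}^\infty p_k(A)z^k=-z\frac{d}{dz}\log A(z)$, and the $t$-deformed cumulants $\kappa_i^t(A)$ and the $t$-deformed cumulant transform $C^t[A]$ are defined by $$C^t[A](z)=\sum_{i=1}^\infty\kappa_i^t(A)z^i=-\frac{z}{t}\frac{d}{dz}\log\left(1+\sum_{k=1}^\infty\frac{t^k}{(t)_{\underline{k}}}a_kz^k\right).$$ For $r\in\mathbb{R}$, the dilation is $D_r[A](z)=A(rz)$. *)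

(* Defs.v *)
From HB Require Import structures.
From mathcomp Require Import all_boot all_order all_algebra.
From mathcomp Require Import boolp reals mpoly.

Set Implicit Arguments.
Unset Strict Implicit.
Unset Printing Implicit Defensive.

Import Order.TTheory GRing.Theory Num.Theory.
Local Open Scope ring_scope.

(* Formal power series, as a commutative ring with the Cauchy product.
   A k is the coefficient of z^k in A.  The sequence of coefficients is wrapped
   in a record because nat -> R already carries a pointwise ring structure. *)
Record fps (R : Type) := FPS { coefs :> nat -> R }.

HB.instance Definition _ (R : Type) := gen_eqMixin (fps R).
HB.instance Definition _ (R : Type) := gen_choiceMixin (fps R).

Lemma fpsP (R : Type) (A B : fps R) : (forall n, A n = B n) <-> A = B.
Proof. by split=> [|-> //]; case: A B => [a] [b] /= /funext ->. Qed.

Section FpsRing.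
Variable R : comNzRingType.
Implicit Types A B C : fps R.

Definition fps_zero : fps R := FPS (fun=> 0).
Definition fps_one : fps R := FPS (fun n => (n == 0%N)%:R).
Definition fps_opp A : fps R := FPS (fun n => - A n).
Definition fps_add A B : fps R := FPS (fun n => A n + B n).
Definition fps_mul A B : fps R :=
  FPS (fun n => \sum_(i < n.+1) A i * B (n - i)%N).
Definition fps_scale (c : R) A : fps R := FPS (fun n => c * A n).

Lemma fps_addA : associative fps_add.
Proof. by move=> A B C; apply/fpsP => n /=; rewrite addrA. Qed.
Lemma fps_addC : commutative fps_add.
Proof. by move=> A B; apply/fpsP => n /=; rewrite addrC. Qed.
Lemma fps_add0 : left_id fps_zero fps_add.
Proof. by move=> A; apply/fpsP => n /=; rewrite add0r. Qed.
Lemma fps_addN : left_inverse fps_zero fps_opp fps_add.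
Proof. by move=> A; apply/fpsP => n /=; rewrite addNr. Qed.

HB.instance Definition _ :=
  GRing.isZmodule.Build (fps R) fps_addA fps_addC fps_add0 fps_addN.

Let trunc m A : {poly R} := \poly_(i < m) A i.

Let truncE m A i : (i < m)%N -> (trunc m A)`_i = A i.
Proof. by move=> im; rewrite coef_poly im. Qed.

Let mul_trunc m A B n : (n < m)%N ->
  fps_mul A B n = (trunc m A * trunc m B)`_n.
Proof.
move=> nm; rewrite coefM; apply: eq_bigr => i _.
rewrite !truncE //; first exact: leq_ltn_trans (leq_subr _ _) nm.
by apply: leq_ltn_trans nm; rewrite -ltnS.
Qed.

Lemma fps_mulA : associative fps_mul.
Proof.
move=> A B C; apply/fpsP => n.
transitivity (trunc n.+1 A * (trunc n.+1 B * trunc n.+1 C))`_n.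
  rewrite coefM; apply: eq_bigr => i _; rewrite truncE //.
  by rewrite (@mul_trunc n.+1) // ltnS leq_subr.
rewrite mulrA coefM; apply: eq_bigr => i _.
by rewrite (@mul_trunc n.+1) // truncE // ltnS leq_subr.
Qed.
Lemma fps_mulC : commutative fps_mul.
Proof. by move=> A B; apply/fpsP => n; rewrite !(@mul_trunc n.+1) // mulrC. Qed.
Lemma fps_mul1 : left_id fps_one fps_mul.
Proof.
move=> A; apply/fpsP => n /=; rewrite big_ord_recl /= mul1r subn0.
by rewrite big1 ?addr0 // => i _; rewrite mul0r.
Qed.
Lemma fps_mulDl : left_distributive fps_mul fps_add.
Proof.
move=> A B C; apply/fpsP => n /=; rewrite -big_split /=.
by apply: eq_bigr => i _; rewrite mulrDl.
Qed.
Lemma fps_one_neq0 : fps_one != 0.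
Proof. by apply/eqP => /fpsP/(_ 0%N)/eqP; rewrite /= oner_eq0. Qed.

HB.instance Definition _ := GRing.Zmodule_isComNzRing.Build (fps R)
  fps_mulA fps_mulC fps_mul1 fps_mulDl fps_one_neq0.

Lemma fps_scaleA a b A : fps_scale a (fps_scale b A) = fps_scale (a * b) A.
Proof. by apply/fpsP => n /=; rewrite mulrA. Qed.
Lemma fps_scale1 : left_id 1 fps_scale.
Proof. by move=> A; apply/fpsP => n /=; rewrite mul1r. Qed.
Lemma fps_scaleDr : right_distributive fps_scale +%R.
Proof. by move=> a A B; apply/fpsP => n /=; rewrite mulrDr. Qed.
Lemma fps_scaleDl A : {morph fps_scale^~ A : a b / a + b}.
Proof. by move=> a b; apply/fpsP => n /=; rewrite mulrDl. Qed.

HB.instance Definition _ := GRing.Zmodule_isLmodule.Build R (fps R)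
  fps_scaleA fps_scale1 fps_scaleDr fps_scaleDl.

Definition fpsZ : fps R := FPS (fun n => (n == 1%N)%:R).

Definition fps_deriv A : fps R := FPS (fun n => A n.+1 *+ n.+1).

(* Substitution F(B(z)), meaningful when B 0 = 0: then B ^+ k has no term of
   degree < k, so that truncating the sum at k = n loses nothing. *)
Definition fps_comp (F B : fps R) : fps R :=
  FPS (fun n => \sum_(k < n.+1) F k * (B ^+ k) n).

Definition fps_dilate (r : R) A : fps R := FPS (fun n => r ^+ n * A n).

End FpsRing.

(* U = 1 + z R[[z]] *)
Record ufps (R : comNzRingType) :=
  UFPS { ufps_val :> fps R; ufps_valP : ufps_val 0%N == 1 }.
HB.instance Definition _ (R : comNzRingType) := [isSub for @ufps_val R].
HB.instance Definition _ (R : comNzRingType) := [Choice of ufps R by <:].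

Lemma dilate_subproof (R : comNzRingType) (r : R) (A : ufps R) :
  fps_dilate r A 0%N == 1.
Proof. by rewrite /= mul1r ufps_valP. Qed.

Definition dilate (R : comNzRingType) (r : R) (A : ufps R) : ufps R :=
  UFPS (dilate_subproof r A).

Section Cumulants.
Variable R : realType.
Implicit Types (t : R) (A B : fps R).

Definition ffactr t (k : nat) : R := \prod_(i < k) (t - i%:R).

(* The formal series of log(1 + z). *)
Definition log1p_series : fps R :=
  FPS (fun k => if k is k'.+1 then (-1) ^+ k' / k%:R else 0).

Definition fps_log A : fps R := fps_comp log1p_series (A - 1).

Definition fps_boxplus t A B : fps R :=
  FPS (fun k => \sum_(i < k.+1)
    ffactr t k / (ffactr t i * ffactr t (k - i)) * A i * B (k - i)%N).

Lemma boxplus_subproof t (A B : ufps R) : fps_boxplus t A B 0%N == 1.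
Proof.
rewrite /= big_ord1 /ffactr !big_ord0 (eqP (ufps_valP A)) (eqP (ufps_valP B)).
by rewrite !mulr1 divr1.
Qed.

Definition boxplus t (A B : ufps R) : ufps R := UFPS (boxplus_subproof t A B).

Definition powersum (k : nat) (A : ufps R) : R :=
  (- (fpsZ R * fps_deriv (fps_log A))) k.

(* For A in U, this is 1 + \sum_(k >= 1) t^k / (t)_k a_k z^k. *)
Definition deform t A : fps R := FPS (fun k => t ^+ k / ffactr t k * A k).

Definition cumulant_transform t (A : ufps R) : fps R :=
  (- t^-1) *: (fpsZ R * fps_deriv (fps_log (deform t A))).

Definition cumulant t (i : nat) (A : ufps R) : R := cumulant_transform t A i.

(* Sequences of maps U -> R are indexed by nat; only indices i >= 1 matter. *)
Implicit Types kappa : nat -> ufps R -> R.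

Definition powersum_leading t kappa : Prop :=
  forall i, (0 < i)%N ->
  exists F : {mpoly R[i.-1]}, forall A : ufps R,
    kappa i A = t ^+ i.-1 / ffactr t i * powersum i A
                + F.@[fun j : 'I_i.-1 => powersum j.+1 A].

Definition homogeneous kappa : Prop :=
  forall i, (0 < i)%N -> forall (r : R) (A : ufps R),
    kappa i (dilate r A) = r ^+ i * kappa i A.

Definition boxplus_additive t kappa : Prop :=
  forall i, (0 < i)%N -> forall A B : ufps R,
    kappa i (boxplus t A B) = kappa i A + kappa i B.

Definition cumulant_axioms t kappa : Prop :=
  [/\ powersum_leading t kappa, homogeneous kappa & boxplus_additive t kappa].

End Cumulants.

(* Main.v *)
Require Import Defs.
From HB Require Import structures.
From mathcomp Require Import all_boot all_order all_algebra.
From mathcomp Require Import boolp reals mpoly ring.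

(** Write D for [deform t A].  The factors (t)_k in the definition of the
    t-deformed convolution are chosen so that A |-> D turns it into the Cauchy
    product ([deform_boxplus]).  The cumulant transform is -1/t times
    z (log D)', and a logarithmic derivative turns products into sums: this is
    additivity.  Homogeneity holds because every operation involved commutes
    with dilation.  The only fact about log that is needed is
    A * (z (log A)') = z A' ([mul_logderiv]); as A has constant term 1 it can be
    cancelled, so this identity characterizes z (log A)'.

    Reading off coefficients gives Newton's identities ([newton_identity]),
    which express k a_k as -p_k plus a polynomial in lower a's and p's, and
    likewise t kappa_k from the coefficients of D.  Hence, by recursion, the
    a_k and the kappa_k are polynomials in p_1, ..., p_k, and one more use of
    the two identities at k isolates the leading term.

    For uniqueness, let delta be the difference of two candidates for kappa_i.
    The leading terms cancel, so delta depends on p_1, ..., p_(i-1) only and is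
    constant on the series congruent to 1 modulo z^i; by additivity the constant
    is 0.  One shows by downward induction on m that delta vanishes on every A
    congruent to 1 modulo z^m ([additive_homogeneous_eq0]).  The first
    nontrivial coefficient is additive under the convolution, so for such an A
    the dilation A(2z) and the 2^m-fold convolution power of A agree modulo
    z^(m+1); by the induction hypothesis delta takes the same value on both,
    that is 2^i delta(A) = 2^m delta(A), and m < i forces delta(A) = 0. *)

Set Implicit Arguments.
Unset Strict Implicit.
Unset Printing Implicit Defensive.

Import Order.TTheory GRing.Theory Num.Theory.
Local Open Scope ring_scope.

(** * Formal power series and the Euler derivation *)

Section Series.
Variable R : comNzRingType.
Implicit Types (A B X Y : fps R) (n k : nat).

Lemma fps_coefD A B n : (A + B) n = A n + B n. Proof. by []. Qed.
Lemma fps_coefN A n : (- A) n = - A n. Proof. by []. Qed.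
Lemma fps_coefB A B n : (A - B) n = A n - B n. Proof. by []. Qed.
Lemma fps_coef1 n : (1 : fps R) n = (n == 0%N)%:R. Proof. by []. Qed.
Lemma fps_coefM A B n : (A * B) n = \sum_(i < n.+1) A i * B (n - i)%N.
Proof. by []. Qed.
Lemma fps_coefZ (c : R) A n : (c *: A) n = c * A n. Proof. by []. Qed.
Lemma fps_coef_dilate (r : R) A n : fps_dilate r A n = r ^+ n * A n.
Proof. by []. Qed.

Lemma fps_coef_sum (I : Type) (r : seq I) (P : pred I) (F : I -> fps R) n :
  (\sum_(i <- r | P i) F i) n = \sum_(i <- r | P i) F i n.
Proof. exact: (big_morph (fun A : fps R => A n)). Qed.

Lemma fps_coefM0 A B : (A * B) 0%N = A 0%N * B 0%N.
Proof. by rewrite fps_coefM big_ord1. Qed.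

Lemma fps_coefX_lt B n k : B 0%N = 0 -> (n < k)%N -> (B ^+ k) n = 0.
Proof.
move=> B0; elim: k n => // k IHk n; rewrite ltnS => le_nk.
rewrite exprS fps_coefM big1 // => -[[|i] lt_in] _ /=.
  by rewrite B0 mul0r.
rewrite IHk ?mulr0 //; apply: leq_trans le_nk.
by rewrite ltn_subrL /= (leq_trans _ (lt_in : (i.+1 <= n)%N)).
Qed.

Lemma fps_mul_lowcoef A X Y n : (forall i, (i <= n)%N -> X i = Y i) ->
  (A * X) n = (A * Y) n.
Proof.
by move=> eqXY; apply: eq_bigr => i _; rewrite eqXY // leq_subr.
Qed.

Lemma fps_mulI A X Y : A 0%N = 1 -> A * X = A * Y -> X = Y.
Proof.
move=> A0 eqAXY; apply/fpsP; elim/ltn_ind => n IHn.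
have /fpsP/(_ n) := eqAXY; rewrite !fps_coefM !big_ord_recl /= A0 !mul1r subn0.
move=> eqn; apply: (addIr (\sum_(i < n) A (bump 0 i) * Y (n - bump 0 i)%N)).
rewrite -eqn; congr (_ + _); apply: eq_bigr => i _.
by rewrite IHn // ltn_subrL /= (leq_trans _ (ltn_ord i)).
Qed.

(** The derivation z d/dz, preferred to d/dz because it is diagonal on
    coefficients. *)
Definition euler A : fps R := fpsZ R * fps_deriv A.

Lemma euler_coef A n : euler A n = A n *+ n.
Proof.
rewrite fps_coefM; case: n => [|n]; first by rewrite big_ord1 mul0r mulr0n.
rewrite big_ord_recl mul0r add0r big_ord_recl big1 /= ?addr0 => [|i _].
  by rewrite mul1r subn1.
by rewrite mul0r.
Qed.

Lemma euler_mul A B : euler (A * B) = euler A * B + A * euler B.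
Proof.
apply/fpsP => n; rewrite euler_coef fps_coefD !fps_coefM -big_split -sumrMnl.
apply: eq_bigr => i _; rewrite !euler_coef mulrnAl mulrnAr /=.
by rewrite -mulrnDr subnKC // -ltnS.
Qed.

Lemma euler_exp B k : euler (B ^+ k.+1) = (B ^+ k * euler B) *+ k.+1.
Proof.
elim: k => [|k IHk]; first by rewrite expr1 expr0 mul1r.
rewrite exprS euler_mul IHk mulrnAr mulrA -exprS mulrC.
by rewrite [RHS]mulrS.
Qed.

Lemma dilate_mul (r : R) A B :
  fps_dilate r (A * B) = fps_dilate r A * fps_dilate r B.
Proof.
apply/fpsP => n; rewrite fps_coefM /= mulr_sumr; apply: eq_bigr => i _.
by rewrite mulrACA -exprD subnKC // -ltnS.
Qed.

Lemma euler_dilate (r : R) A : euler (fps_dilate r A) = fps_dilate r (euler A).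
Proof. by apply/fpsP => n; rewrite !(euler_coef, fps_coef_dilate) mulrnAr. Qed.

End Series.

(** * The logarithmic derivative and Newton's identities *)

(** Locked, since unification would otherwise unfold the power series of log
    whenever it compares two coefficients. *)
HB.lock Definition logderiv (R : realType) (A : fps R) : fps R :=
  euler (fps_log A).

Section LogDerivative.
Variable R : realType.
Implicit Types (A B X : fps R) (n k : nat).

(** Modulo z^(n+1) the series log (1 + B) is a polynomial in B, whose Euler
    derivative is a finite geometric sum times [euler B]; multiplying by
    A = 1 + B telescopes the sum up to a term in B ^+ n.+1. *)
Lemma mul_logderiv A : A 0%N = 1 -> A * logderiv A = euler A.
Proof.
move=> A0; apply/fpsP => n.
set B := A - 1; have B0 : B 0%N = 0 by rewrite fps_coefB A0 fps_coef1 subrr.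
pose L := \sum_(k < n.+2) log1p_series R k *: B ^+ k.
have LE i : (i <= n)%N -> fps_log A i = L i.
  move=> le_in; rewrite fps_coef_sum /=.
  rewrite (big_ord_widen n.+2 (fun k => log1p_series R k * (B ^+ k) i)).
    rewrite big_mkcond; apply: eq_bigr => k _; case: ifPn => //.
    by rewrite -leqNgt => lt_ik; rewrite fps_coefX_lt ?mulr0.
  by rewrite ltnS leqW.
have eulerL : euler L = (\sum_(k < n.+1) (- B) ^+ k) * euler B.
  rewrite mulr_suml; apply/fpsP => m; rewrite euler_coef !fps_coef_sum.
  rewrite big_ord_recl fps_coefZ [X in X * _](_ : _ = 0) // mul0r add0r.
  rewrite -sumrMnl; apply: eq_bigr => k _.
  rewrite fps_coefZ -mulrnAr -euler_coef [X in B ^+ X]lift0 euler_exp.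
  rewrite -scaler_nat fps_coefZ mulrA [X in X * _](_ : _ = (-1) ^+ k).
    rewrite (exprNn B) -!(signr_odd _ k); case: (odd k); last first.
      by rewrite !expr0 !mul1r.
    by rewrite !expr1 !mulN1r mulNr.
  by rewrite /= divfK // pnatr_eq0.
have AE : A = - (- B - 1) by rewrite opprB opprK addrC subrK.
have geom : A * \sum_(k < n.+1) (- B) ^+ k = 1 - (- B) ^+ n.+1.
  by rewrite {1}AE mulNr -subrX1 opprB.
rewrite (@fps_mul_lowcoef _ _ _ (euler L)) => [|i le_in]; last first.
  by rewrite unlock !euler_coef LE.
rewrite eulerL mulrA geom mulrBl mul1r fps_coefB.
rewrite [X in _ - X]fps_coefM big1 => [|i _].
  rewrite subr0 !euler_coef fps_coefB fps_coef1.
  by case: n {L LE eulerL geom} => [|n]; rewrite ?mulr0n //= subr0.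
have NB0 : (- B) 0%N = 0 by rewrite fps_coefN B0 oppr0.
by rewrite fps_coefX_lt ?mul0r.
Qed.

(** Cancelling A makes [mul_logderiv] a characterization; product and dilation
    rules are then read off from those of [euler]. *)
Lemma logderiv_unique A X : A 0%N = 1 -> A * X = euler A -> logderiv A = X.
Proof. by move=> A0 AX; apply: (fps_mulI A0); rewrite mul_logderiv. Qed.

Lemma logderivM A B : A 0%N = 1 -> B 0%N = 1 ->
  logderiv (A * B) = logderiv A + logderiv B.
Proof.
move=> A0 B0; apply: logderiv_unique; first by rewrite fps_coefM0 A0 B0 mulr1.
rewrite euler_mul -(mul_logderiv A0) -(mul_logderiv B0) mulrDr.
by congr (_ + _); [exact: mulrAC | exact/esym/mulrA].
Qed.

Lemma logderiv_dilate (r : R) A : A 0%N = 1 ->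
  logderiv (fps_dilate r A) = fps_dilate r (logderiv A).
Proof.
move=> A0; apply: logderiv_unique; first by rewrite /= A0 mulr1.
by rewrite -dilate_mul mul_logderiv // euler_dilate.
Qed.

Lemma logderiv0 A : logderiv A 0%N = 0.
Proof. by rewrite unlock euler_coef. Qed.

Definition newton_sum A n : R := \sum_(j < n) A j.+1 * logderiv A (n - j)%N.

(** The coefficient of z^(n+1) in [mul_logderiv], solved for the unknown of
    highest index; [newton_sum] involves indices from 1 to n only. *)
Lemma newton_identity A n : A 0%N = 1 ->
  logderiv A n.+1 = A n.+1 *+ n.+1 - newton_sum A n.
Proof.
move=> A0; have /fpsP/(_ n.+1) := mul_logderiv A0.
rewrite euler_coef fps_coefM.
rewrite -(big_mkord xpredT (fun j => A j * logderiv A (n.+1 - j)%N)).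
rewrite big_nat_recl // big_nat_recr // big_mkord A0 mul1r subn0 subnn.
by rewrite logderiv0 mulr0 Monoid.mulm1 => <-; rewrite addrK.
Qed.

End LogDerivative.

(** * The cumulants satisfy the three conditions *)

Section Existence.
Variables (R : realType) (t : R).
Hypothesis ht : forall n : nat, t != n%:R.
Implicit Types A B : ufps R.

Lemma ffactr_neq0 k : ffactr t k != 0.
Proof. by apply/prodf_neq0 => i _; rewrite subr_eq0 ht. Qed.

Lemma ufps_coef0 A : A 0%N = 1. Proof. exact/eqP/(ufps_valP A). Qed.

Lemma deform0 A : deform t A 0%N = 1.
Proof. by rewrite /= ufps_coef0 /ffactr big_ord0 expr0 divr1 mulr1. Qed.

Lemma deform_boxplus A B : deform t (boxplus t A B) = deform t A * deform t B.
Proof.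
apply/fpsP => n; rewrite fps_coefM /= mulr_sumr; apply: eq_bigr => i _.
have -> : t ^+ n = t ^+ i * t ^+ (n - i) by rewrite -exprD subnKC // -ltnS.
by field; rewrite !ffactr_neq0.
Qed.

Lemma deform_dilate (r : R) A :
  deform t (dilate r A) = fps_dilate r (deform t A).
Proof. by apply/fpsP => n; rewrite /= mulrCA. Qed.

Lemma cumulant_transformE A :
  cumulant_transform t A = - t^-1 *: logderiv (deform t A).
Proof. by rewrite unlock. Qed.

Lemma powersumE k A : powersum k A = - logderiv A k.
Proof. by rewrite unlock. Qed.

Lemma cumulantE k A : cumulant t k A = - t^-1 * logderiv (deform t A) k.
Proof. by rewrite /cumulant cumulant_transformE. Qed.

Lemma cumulant_transform_boxplus A B :
  cumulant_transform t (boxplus t A B)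
  = cumulant_transform t A + cumulant_transform t B.
Proof.
by rewrite !cumulant_transformE deform_boxplus logderivM ?deform0 // scalerDr.
Qed.

Lemma cumulant_homogeneous : homogeneous (cumulant t).
Proof.
move=> i _ r A; rewrite !cumulantE deform_dilate logderiv_dilate ?deform0 //=.
by rewrite mulrCA.
Qed.

(** The number n of variables is fixed while the index of the quantity under
    study runs up to n, so that recursions on the index never have to change
    the polynomial ring. *)
Definition polynomial_in_powersums n (f : ufps R -> R) : Prop :=
  exists F : {mpoly R[n]},
    forall A, f A = F.@[fun j : 'I_n => powersum j.+1 A].

Local Notation poly_ps := polynomial_in_powersums.

Section Closure.
Variable n : nat.
Implicit Types f g : ufps R -> R.

Lemma poly_ps_const c : poly_ps n (fun=> c).
Proof. by exists (c%:MP) => A; rewrite mevalC. Qed.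

Lemma poly_ps_logderiv k : (k <= n)%N -> poly_ps n (fun A => logderiv A k).
Proof.
case: k => [|k] lt_kn.
  by exists 0 => A; rewrite meval0 logderiv0.
exists (- 'X_(Ordinal lt_kn)) => A.
by rewrite mevalN mevalXU powersumE opprK.
Qed.

Lemma poly_ps_add f g :
  poly_ps n f -> poly_ps n g -> poly_ps n (fun A => f A + g A).
Proof. by move=> [F fF] [G gG]; exists (F + G) => A; rewrite mevalD fF gG. Qed.

Lemma poly_ps_mul f g :
  poly_ps n f -> poly_ps n g -> poly_ps n (fun A => f A * g A).
Proof. by move=> [F fF] [G gG]; exists (F * G) => A; rewrite mevalM fF gG. Qed.

Lemma poly_ps_scale c f : poly_ps n f -> poly_ps n (fun A => c * f A).
Proof. exact/poly_ps_mul/poly_ps_const. Qed.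

Lemma poly_ps_sub f g :
  poly_ps n f -> poly_ps n g -> poly_ps n (fun A => f A - g A).
Proof. by move=> [F fF] [G gG]; exists (F - G) => A; rewrite mevalB fF gG. Qed.

Lemma poly_ps_sum (I : Type) (r : seq I) (f : I -> ufps R -> R) :
  (forall i, poly_ps n (f i)) -> poly_ps n (fun A => \sum_(i <- r) f i A).
Proof.
move=> fP; elim: r => [|i r [F fF]].
  by exists 0 => A; rewrite big_nil meval0.
have [G gG] := fP i; exists (G + F) => A.
by rewrite big_cons mevalD fF gG.
Qed.

Lemma poly_ps_ext f g : f =1 g -> poly_ps n g -> poly_ps n f.
Proof. by move=> fg [F gF]; exists F => A; rewrite fg gF. Qed.

Lemma poly_ps_newton_sum (D : ufps R -> fps R) k :
    (forall j, (j <= k)%N -> poly_ps n (fun A => D A j)) ->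
    (forall j, (j <= k)%N -> poly_ps n (fun A => logderiv (D A) j)) ->
  poly_ps n (fun A => newton_sum (D A) k).
Proof.
move=> DP LP; apply: poly_ps_sum => j; apply: poly_ps_mul; first exact: DP.
by apply: LP; rewrite leq_subr.
Qed.

(** Newton's identity solved for the coefficient, which requires dividing by
    the index. *)
Lemma poly_ps_coef k : (k <= n)%N -> poly_ps n (fun A => A k).
Proof.
elim/ltn_ind: k => -[|k] IHk le_kn.
  by apply: poly_ps_ext (poly_ps_const 1) => A; rewrite ufps_coef0.
apply: (@poly_ps_ext _
  (fun A => k.+1%:R^-1 * (logderiv A k.+1 + newton_sum A k))) => [A|].
  rewrite newton_identity ?ufps_coef0 // subrK -[A _ *+ _]mulr_natl mulKf //.
  by rewrite pnatr_eq0.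
apply/poly_ps_scale/poly_ps_add; first exact: poly_ps_logderiv.
apply: poly_ps_newton_sum => j le_jk.
  exact: IHk (leq_trans le_jk (ltnW le_kn)).
by apply: poly_ps_logderiv; apply: leq_trans le_jk (ltnW le_kn).
Qed.

Lemma poly_ps_deform k : (k <= n)%N -> poly_ps n (fun A => deform t A k).
Proof. by move=> le_kn; apply/poly_ps_scale/poly_ps_coef. Qed.

Lemma poly_ps_logderiv_deform k :
  (k <= n)%N -> poly_ps n (fun A => logderiv (deform t A) k).
Proof.
elim/ltn_ind: k => -[|k] IHk le_kn.
  by apply: poly_ps_ext (poly_ps_const 0) => A; rewrite logderiv0.
apply: (@poly_ps_ext _ (fun A =>
  k.+1%:R * deform t A k.+1 - newton_sum (deform t A) k)) => [A|].
  by rewrite newton_identity ?deform0 // mulr_natl.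
apply: poly_ps_sub; first exact/poly_ps_scale/poly_ps_deform.
apply: poly_ps_newton_sum => j le_jk.
  by apply: poly_ps_deform; apply: leq_trans le_jk (ltnW le_kn).
by apply: IHk => //; apply: leq_trans le_jk (ltnW le_kn).
Qed.

End Closure.

(** Newton's identity is used twice at the top index: for the deformed series,
    to reach its coefficient of z^(n+1), and for A, to exchange that coefficient
    for the power sum of index n.+1. *)
Lemma cumulant_powersum_leading : powersum_leading t (cumulant t).
Proof.
case=> // n _ /=.
set c := t ^+ n.+1 / ffactr t n.+1.
have [F FE] : poly_ps n (fun A =>
    - t^-1 * (c * newton_sum A n - newton_sum (deform t A) n)).
  apply/poly_ps_scale/poly_ps_sub; first apply: poly_ps_scale.
    apply: (@poly_ps_newton_sum _ (fun A => A)) => j; first exact: poly_ps_coef.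
    exact: poly_ps_logderiv.
  apply: poly_ps_newton_sum; first exact: poly_ps_deform.
  exact: poly_ps_logderiv_deform.
exists F => A; rewrite -FE cumulantE powersumE.
have t0 : t != 0 by have := ht 0.
have -> : t ^+ n / ffactr t n.+1 = t^-1 * c by rewrite mulrA exprS mulKf.
rewrite (newton_identity n (deform0 A)) (newton_identity n (ufps_coef0 A)).
rewrite (_ : deform t A n.+1 = c * A n.+1) //.
move: (newton_sum A n) (newton_sum (deform t A) n) (A n.+1) => x y z.
ring.
Qed.

Lemma cumulant_boxplus_additive : boxplus_additive t (cumulant t).
Proof. by move=> i _ A B; rewrite /cumulant cumulant_transform_boxplus. Qed.

End Existence.

(** * Uniqueness *)

Section Uniqueness.
Variables (R : realType) (t : R).
Hypothesis ht : forall n : nat, t != n%:R.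
Implicit Types A B : ufps R.

Definition trivial_below m A : Prop := forall k, (0 < k < m)%N -> A k = 0.

(** All mixed terms of the convolution contain a vanishing coefficient of A, and
    the two extreme terms have weight 1. *)
Lemma boxplus_coef A B m : (0 < m)%N -> trivial_below m A ->
  boxplus t A B m = A m + B m.
Proof.
case: m => // m _ lowA; rewrite /= big_ord_recl big_ord_recr /= !ufps_coef0.
have f0 : ffactr t 0 = 1 by rewrite /ffactr big_ord0.
rewrite subn0 subnn f0 ufps_coef0 mul1r !mulr1 divff ?ffactr_neq0 // !mul1r.
rewrite big1 ?add0r; first by rewrite addrC.
by move=> i _; rewrite lowA ?mulr0 ?mul0r // /bump /= ltnS ltn_ord.
Qed.

Lemma trivial_below_boxplus A B m :
  trivial_below m A -> trivial_below m B -> trivial_below m (boxplus t A B).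
Proof.
move=> lowA lowB k /andP[k0 lt_km]; rewrite boxplus_coef //.
  by rewrite lowA ?lowB ?addr0 ?k0.
by move=> j /andP[j0 lt_jk]; rewrite lowA // j0 (ltn_trans lt_jk).
Qed.

Definition binomial_coefs (m : nat) (c : R) : fps R :=
  FPS (fun k => if k == 0%N then 1 else if k == m then c else 0).

Definition binomial_series m c : ufps R :=
  UFPS (eqxx 1 : binomial_coefs m c 0%N == 1).

Lemma trivial_below_binomial m c : trivial_below m (binomial_series m c).
Proof. by move=> k /andP[k0 km] /=; rewrite gtn_eqF // ltn_eqF. Qed.

Section Rigidity.
Variables (i : nat) (delta : ufps R -> R).
Hypothesis delta_dilate : forall r A, delta (dilate r A) = r ^+ i * delta A.
Hypothesis delta_boxplus :
  forall A B, delta (boxplus t A B) = delta A + delta B.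
Hypothesis delta_trivial : forall A, trivial_below i A -> delta A = 0.

(** The n-fold convolution power of A. *)
Lemma boxplus_multiple m A n : (0 < m)%N -> trivial_below m A ->
  exists B, [/\ trivial_below m B, B m = n%:R * A m & delta B = n%:R * delta A].
Proof.
move=> m0 lowA; elim: n => [|n [B [lowB Bm dB]]].
  (* The 0-fold power is the series 1. *)
  exists (binomial_series i 0); split.
  - by move=> k /andP[k0 _] /=; rewrite gtn_eqF // if_same.
  - by rewrite /= gtn_eqF // if_same mul0r.
  by rewrite mul0r delta_trivial //; apply: trivial_below_binomial.
exists (boxplus t A B); split; first exact: trivial_below_boxplus.
  by rewrite boxplus_coef // Bm -nat1r mulrDl mul1r.
by rewrite delta_boxplus dB -nat1r mulrDl mul1r.
Qed.

(** At order p, homogeneity scales delta by 2^i and additivity by 2^p on two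
    series that delta cannot distinguish. *)
Lemma additive_homogeneous_eq0 A : delta A = 0.
Proof.
suff main m : (m < i)%N -> forall B, trivial_below (i - m) B -> delta B = 0.
  have [i1|i1] := leqP i 1.
    by apply: delta_trivial => k; case: k => // k /= /leq_trans/(_ i1).
  apply: (main i.-1); first by rewrite ltn_predL ltnW.
  by rewrite -subn1 subKn ?(ltnW i1) // => -[].
elim: m => [|m IHm] lt_mi B lowB.
  by apply: delta_trivial; rewrite subn0 in lowB.
have {}IHm := IHm (ltnW lt_mi).
set p := (i - m.+1)%N in lowB.
have p0 : (0 < p)%N by rewrite subn_gt0.
have pS : (i - m)%N = p.+1 by rewrite subnSK // ltnW.
have lt_pi : (p < i)%N by rewrite -pS leq_subr.
(* delta has opposite values on series with opposite leading coefficients,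
   because their convolution is trivial one order higher. *)
have kill X Y : trivial_below p X -> trivial_below p Y -> X p + Y p = 0 ->
    delta X + delta Y = 0.
  move=> lowX lowY XY0; rewrite -delta_boxplus; apply: IHm; rewrite pS.
  move=> k /andP[k0]; rewrite ltnS leq_eqVlt => /orP[/eqP ->|lt_kp].
    by rewrite boxplus_coef.
  by apply: (trivial_below_boxplus lowX lowY); rewrite k0.
have [P [lowP Pp dP]] := boxplus_multiple (2 ^ p) p0 lowB.
(* Q cancels the leading term of both B(2z) and P, which gives
   delta (B(2z)) = - delta Q = delta P. *)
pose Q := binomial_series p (- (2 ^ p)%:R * B p).
have lowQ : trivial_below p Q by apply: trivial_below_binomial.
have Qp : Q p = - (2 ^ p)%:R * B p by rewrite /= eqxx gtn_eqF.
have lowD : trivial_below p (dilate 2 B) by move=> k /lowB /= ->; rewrite mulr0.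
have Dp : (dilate 2 B) p = (2 ^ p)%:R * B p by rewrite /= natrX.
have eqDP : delta (dilate 2 B) = delta P.
  apply: (addIr (delta Q)).
  by rewrite !kill ?Dp ?Pp ?Qp ?mulNr ?subrr.
move: eqDP; rewrite delta_dilate dP natrX => /eqP.
rewrite -subr_eq0 -mulrBl mulf_eq0 => /orP[|/eqP //].
by rewrite subr_eq0 -!natrX eqr_nat eqn_exp2l ?gtn_eqF.
Qed.

End Rigidity.

Lemma powersum_trivial_below i k A : trivial_below i A -> (k < i)%N ->
  powersum k A = 0.
Proof.
move=> lowA; case: k => [|k] lt_ki; rewrite powersumE.
  by rewrite logderiv0 oppr0.
rewrite newton_identity ?ufps_coef0 // lowA // mul0rn.
rewrite /newton_sum big1 ?subr0 ?oppr0 // => j _.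
rewrite lowA ?mul0r //=; apply: leq_ltn_trans lt_ki.
by rewrite ltnS ltnW.
Qed.

Lemma cumulant_axioms_unique kappa kappa' :
    cumulant_axioms t kappa -> cumulant_axioms t kappa' ->
  forall i, (0 < i)%N -> forall A, kappa i A = kappa' i A.
Proof.
move=> [ps hom addk] [ps' hom' addk'] i i0 A; apply/eqP; rewrite -subr_eq0.
apply/eqP; pose delta B := kappa i B - kappa' i B.
have delta_dilate r B : delta (dilate r B) = r ^+ i * delta B.
  by rewrite /delta hom // hom' // mulrBr.
have delta_add B C : delta (boxplus t B C) = delta B + delta C.
  by rewrite /delta addk // addk' // opprD addrACA.
apply: (additive_homogeneous_eq0 delta_dilate delta_add) => B lowB.
have [F FE] := ps i i0; have [F' FE'] := ps' i i0.
have const C : trivial_below i C -> delta C = F.@[fun=> 0] - F'.@[fun=> 0].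
  move=> lowC; rewrite /delta FE FE' opprD addrACA subrr add0r.
  have C0 (j : 'I_i.-1) : powersum j.+1 C = 0.
    by apply: powersum_trivial_below lowC _; rewrite -ltn_predRL.
  by congr (_ - _); apply: meval_eq => j.
(* B boxplus B is again trivial below i, so the constant c is c + c. *)
have := delta_add B B; rewrite !const //; last exact: trivial_below_boxplus.
by move/eqP; rewrite -subr_eq0 opprD addNKr oppr_eq0 => /eqP.
Qed.

End Uniqueness.

Theorem theorem2p4 (R : realType) (t : R) (ht : forall n : nat, t != n%:R) :
  [/\ cumulant_axioms t (cumulant t),
      forall A B : ufps R,
        cumulant_transform t (boxplus t A B)
        = cumulant_transform t A + cumulant_transform t B
    & forall kappa : nat -> ufps R -> R, cumulant_axioms t kappa ->
        forall i, (0 < i)%N -> forall A : ufps R, kappa i A = cumulant t i A].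
Proof.
have cumulantP : cumulant_axioms t (cumulant t).
  split; [exact: cumulant_powersum_leading | exact: cumulant_homogeneous
         | exact: cumulant_boxplus_additive].
split=> // [A B|kappa kappaP]; first exact: cumulant_transform_boxplus.
exact: cumulant_axioms_unique.
Qed.
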